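(* Let $p\in(1,2]$. Then $[\mathcal{T}_p^{\mathrm{Lip}_0},\|\cdot\|_{\mathcal{T}_p^{\mathrm{Lip}}}]$ is a Banach Lipschitz ideal.
   Context: $\mathbb{K}$ is the scalar field ($\mathbb{R}$ or $\mathbb{C}$). For Banach spaces $X,E$, $\mathcal{L}(X,E)$ is the space of bounded linear operators, and $\mathrm{Lip}_0(X,E)$ is the Banach space of Lipschitz maps $f:X\to E$ with $f(0)=0$, normed by $\mathrm{Lip}(f)=\sup_{x\ne y}\|f(x)-f(y)\|/\|x-y\|$; $\mathrm{Lip}_0(X)=\mathrm{Lip}_0(X,\mathbb{K})$. $(r_n)_{n\in\mathbb{N}}$ are the Rademacher functions on $[0,1]$. $f\in\mathrm{Lip}_0(X,E)$ has type $p$ if there is $C>0$ such that for all $N\in\mathbb{N}$, $(\lambda_1,\ldots,\lambda_N)\in\mathbb{R}^N$ and $(x_1,\ldots,x_N),(y_1,\ldots,y_N)\in X^N$, $$\left(\int_0^1\Big\|\sum_{k=1}^N\lambda_k r_k(t)(f(x_k)-f(y_k))\Big\|_E^2dt\right)^{1/2}\le C\left(\sum_{k=1}^N|\lambda_k|^p\|x_k-y_k\|_X^p\right)^{1/p}.$$ The set of such $f$ is $\mathcal{T}_p^{\mathrm{Lip}_0}(X,E)$ and $\|f\|_{\mathcal{T}_p^{\mathrm{Lip}}}$ is the infimum of all such $C$. A Banach Lipschitz ideal is a subclass $\mathcal{A}$ of the class of all zero-preserving Lipschitz maps between Banach spaces, with a map $\|\cdot\|_{\mathcal{A}}:\mathcal{A}\to[0,\infty)$,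 such that for all Banach spaces $X,E$ the components $\mathcal{A}(X,E):=\mathrm{Lip}_0(X,E)\cap\mathcal{A}$ satisfy: (i) $(\mathcal{A}(X,E),\|\cdot\|_{\mathcal{A}})$ is a Banach space and $\mathrm{Lip}(f)\le\|f\|_{\mathcal{A}}$ for all $f\in\mathcal{A}(X,E)$; (ii) for all $h\in\mathrm{Lip}_0(X)$ and $y\in E$, the map $h\cdot y:x\mapsto h(x)y$ is in $\mathcal{A}(X,E)$ and $\|h\cdot y\|_{\mathcal{A}}=\mathrm{Lip}(h)\|y\|$; (iii) for all Banach spaces $X_0,E_0$, $T\in\mathcal{L}(E,E_0)$, $f\in\mathcal{A}(X,E)$, $h\in\mathrm{Lip}_0(X_0,X)$, one has $T\circ f\circ h\in\mathcal{A}(X_0,E_0)$ with $\|T\circ f\circ h\|_{\mathcal{A}}\le\|T\|\,\|f\|_{\mathcal{A}}\,\mathrm{Lip}(h)$. *)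

(* Defs.v *)
From HB Require Import structures.
From mathcomp Require Import all_boot all_order all_algebra.
From mathcomp Require Import complex.
From mathcomp Require Import all_classical all_reals all_analysis.
Set Implicit Arguments.
Unset Strict Implicit.
Unset Printing Implicit Defensive.
Import Order.TTheory GRing.Theory Num.Theory.
Import numFieldNormedType.Exports.
Local Open Scope classical_set_scope.
Local Open Scope ring_scope.

(* In MathComp-Analysis the norm of a normedModType K takes its values in K,
   so a scalar field comes with maps from and to the reals: [real_part] is only
   applied to norms (see [nrm]) and [of_real] to real coefficients. Only the
   two instances below are of interest. *)
Record scalar_field (R : realType) := ScalarField {
  scalars :> numFieldType;
  of_real : R -> scalars;
  real_part : scalars -> R }.

Definition real_scalars (R : realType) : scalar_field R :=
  @ScalarField R R (fun x : R => x) (fun x : R => x).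

Definition complex_scalars (R : realType) : scalar_field R :=
  @ScalarField R R[i] (fun x : R => Complex x 0) (fun z : R[i] => complex.Re z).

Definition nrm (R : realType) (K : scalar_field R) (V : normedModType K)
  (v : V) : R := real_part `|v|.

(* A bound k for a complex space is necessarily real and nonnegative, unless
   X = 0, because the order of R[i] only compares numbers with the same
   imaginary part. *)
Definition Lip0 (R : realType) (K : scalar_field R) (X E : normedModType K) :
  set (X -> E) := [set f | f 0 = 0 /\ exists k : K, k.-lipschitz f].

(* The supremum of the empty set is 0, which gives Lip f = 0 when X = 0. *)
Definition Lip (R : realType) (K : scalar_field R) (X E : normedModType K)
    (f : X -> E) : R :=
  sup [set c | exists x y : X, x != y /\ c = nrm (f x - f y) / nrm (x - y)].

Definition bounded_linear (R : realType) (K : scalar_field R)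
    (E F : normedModType K) (T : E -> F) : Prop :=
  linear T /\ exists M : R, forall x : E, nrm (T x) <= M * nrm x.

Definition opnorm (R : realType) (K : scalar_field R)
    (E F : normedModType K) (T : E -> F) : R :=
  sup [set nrm (T x) | x in [set x : E | nrm x <= 1]].

Definition is_banach_space (R : realType) (K : scalar_field R) (V : lmodType K)
    (S : set V) (N : V -> R) : Prop :=
  [/\ [/\ S 0,
          forall u v, S u -> S v -> S (u + v) &
          forall (a : K) u, S u -> S (a *: u)],
      [/\ forall u, S u -> 0 <= N u,
          forall u, S u -> N u = 0 -> u = 0,
          forall u v, S u -> S v -> N (u + v) <= N u + N v &
          forall (a : K) u, S u -> N (a *: u) = real_part `|a| * N u] &
      forall u : nat -> V, (forall n, S (u n)) ->
        (forall e : R, 0 < e -> exists n0, forall m n,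
          (n0 <= m)%N -> (n0 <= n)%N -> N (u m - u n) < e) ->
        exists2 v, S v &
          forall e : R, 0 < e -> exists n0, forall n,
            (n0 <= n)%N -> N (u n - v) < e].

Record banach_lipschitz_ideal (R : realType) (K : scalar_field R)
    (A : forall X E : completeNormedModType K, set (X -> E))
    (normA : forall X E : completeNormedModType K, (X -> E) -> R) : Prop := {
  bli_sub : forall X E : completeNormedModType K, A X E `<=` @Lip0 R K X E;
  bli_ge0 : forall (X E : completeNormedModType K) (f : X -> E),
    A X E f -> 0 <= normA X E f;
  bli_banach : forall X E : completeNormedModType K,
    is_banach_space (A X E) (normA X E);
  bli_Lip_le : forall (X E : completeNormedModType K) (f : X -> E),
    A X E f -> Lip f <= normA X E f;
  bli_rank1 : forall (X E : completeNormedModType K) (h : X -> K) (y : E),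
    Lip0 h ->
    A X E (fun x => h x *: y) /\
    normA X E (fun x => h x *: y) = Lip h * nrm y;
  bli_comp : forall (X0 X E E0 : completeNormedModType K)
      (T : E -> E0) (f : X -> E) (h : X0 -> X),
    bounded_linear T -> A X E f -> Lip0 h ->
    A X0 E0 (T \o f \o h) /\
    normA X0 E0 (T \o f \o h) <= opnorm T * normA X E f * Lip h }.

Definition rademacher (R : realType) (n : nat) (t : R) : R :=
  Num.sg (sin (2 ^+ n * pi * t)).

(* The Rademacher functions are indexed from 1, hence the k.+1. *)
Definition type_ineq (R : realType) (K : scalar_field R) (p : R)
    (X E : normedModType K) (f : X -> E) (C : R) : Prop :=
  forall (N : nat) (a : 'I_N -> R) (x y : 'I_N -> X),
    ((\int[lebesgue_measure]_(t in `[0%R, 1%R])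
        ((nrm (\sum_(k < N) of_real K (a k * rademacher k.+1 t) *:
                 (f (x k) - f (y k)))) ^+ 2)%:E) `^ 2^-1
     <= (C * (\sum_(k < N) `|a k| `^ p * nrm (x k - y k) `^ p) `^ p^-1)%:E)%E.

Definition lip_type (R : realType) (K : scalar_field R) (p : R)
    (X E : completeNormedModType K) : set (X -> E) :=
  [set f | Lip0 f /\ exists2 C : R, 0 < C & type_ineq p f C].

Definition lip_type_norm (R : realType) (K : scalar_field R) (p : R)
    (X E : completeNormedModType K) (f : X -> E) : R :=
  inf [set C : R | 0 < C /\ type_ineq p f C].

(* Main.v *)
(** The sign vector (r_1, ..., r_N) takes each value in {-1, 1}^N on a union of
    dyadic intervals of total length 2^-N, so the integral in the type
    inequality is a finite average [avg].  Its square root [phi] is a seminorm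
    in (w_1, ..., w_N); type p says that [phi] of the differences is at most C
    times an l_p norm.  For fixed data this bound is stable under sums, under
    composition and under pointwise limits, which gives the Banach space and
    ideal properties, while N = 1 gives Lip f <= C.  For scalar-valued maps the
    parallelogram law turns [phi] into an l_2 norm, and l_2 <= l_p for p <= 2
    gives the norm of rank-one maps. *)
Require Import Defs.
From mathcomp Require Import all_boot all_order all_algebra.
From mathcomp Require Import complex ring lra.
From mathcomp Require Import all_classical all_reals all_analysis.
From mathcomp Require Import measurable_realfun.
Set Implicit Arguments.
Unset Strict Implicit.
Unset Printing Implicit Defensive.
Import Order.TTheory GRing.Theory Num.Theory.
Import numFieldNormedType.Exports.
Local Open Scope classical_set_scope.
Local Open Scope ring_scope.

(** * Averages over sign vectors *)

(** The head sign is averaged last in the recursion, over its two values, which matches the halving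
    of an interval in [integral_dyadic]. *)
Fixpoint avg (R : realType) (N : nat) (g : seq R -> R) : R :=
  if N is N'.+1 then
    (avg N' (fun s => g (1 :: s)) + avg N' (fun s => g (-1 :: s))) / 2
  else g [::].

(** [avg] evaluates only at sign vectors, and [nth] returns 0 past the end; hence all entries of [s]
    may be taken of modulus at most 1. *)
Lemma ler_avg (R : realType) N (u v : seq R -> R) :
  (forall s, (forall i, `|s`_i| <= 1) -> u s <= v s) -> avg N u <= avg N v.
Proof.
elim: N u v => [|N IH] u v uv /=.
  by apply: uv => i; rewrite nth_nil normr0.
have cons_le1 e s : `|e| = 1 :> R -> (forall i, `|s`_i| <= 1) ->
    forall i, `|(e :: s)`_i| <= 1.
  by move=> e1 s1 [|i] /=; rewrite ?e1.
by rewrite ler_pM2r ?invr_gt0// lerD// IH// => s s1; apply: uv;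
  apply: cons_le1; rewrite // ?normrN normr1.
Qed.

Lemma eq_avg (R : realType) N (u v : seq R -> R) :
  u =1 v -> avg N u = avg N v.
Proof. by move=> /funext ->. Qed.

Lemma avgD (R : realType) N (u v : seq R -> R) :
  avg N (fun s => u s + v s) = avg N u + avg N v.
Proof. by elim: N u v => [|N IH] u v //=; rewrite !IH; field. Qed.

Lemma avgZ (R : realType) N c (u : seq R -> R) :
  avg N (fun s => c * u s) = c * avg N u.
Proof. by elim: N u => [|N IH] u //=; rewrite !IH; field. Qed.

Lemma avg_cst (R : realType) N (c : R) : avg N (fun=> c) = c.
Proof. by elim: N => [|N IH] //=; rewrite !IH; field. Qed.

Lemma avg_ge0 (R : realType) N (u : seq R -> R) :
  (forall s, 0 <= u s) -> 0 <= avg N u.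
Proof. by move=> u0; rewrite -(avg_cst N 0); apply: ler_avg => s _. Qed.

(** Averaging a convexity bound for the square, with weights [a > A] and [b > B], gives at most
    [(a + b)^2]. *)
Lemma avg_minkowski (R : realType) N (u v : seq R -> R) :
  Num.sqrt (avg N (fun s => (u s + v s) ^+ 2)) <=
  Num.sqrt (avg N (fun s => u s ^+ 2)) + Num.sqrt (avg N (fun s => v s ^+ 2)).
Proof.
set A := Num.sqrt (avg N (fun s => u s ^+ 2)).
set B := Num.sqrt (avg N (fun s => v s ^+ 2)).
have A2 : avg N (fun s => u s ^+ 2) = A ^+ 2.
  by rewrite sqr_sqrtr// avg_ge0// => s; rewrite sqr_ge0.
have B2 : avg N (fun s => v s ^+ 2) = B ^+ 2.
  by rewrite sqr_sqrtr// avg_ge0// => s; rewrite sqr_ge0.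
have A0 : 0 <= A by exact: sqrtr_ge0.
have B0 : 0 <= B by exact: sqrtr_ge0.
apply/ler_addgt0Pr => e e0.
(* [A] or [B] may vanish; the shift by [e / 2] allows division. *)
set a := A + e / 2; set b := B + e / 2.
have a0 : 0 < a by rewrite /a; lra.
have b0 : 0 < b by rewrite /b; lra.
have -> : A + B + e = a + b by rewrite /a /b; field.
(* convexity of the square: [(x + y)^2 <= (a + b) (x^2 / a + y^2 / b)] *)
have cvx x y : (x + y) ^+ 2 <= (a + b) / a * x ^+ 2 + (a + b) / b * y ^+ 2.
  rewrite -subr_ge0 [X in 0 <= X](_ : _ = (x * b - y * a) ^+ 2 / (a * b)).
    by rewrite divr_ge0 ?sqr_ge0// ltW// mulr_gt0.
  by field; rewrite !gt_eqF.
have ab0 : 0 <= a + b by rewrite ltW// addr_gt0.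
rewrite -[leRHS]ger0_norm// -sqrtr_sqr ler_wsqrtr//.
apply: le_trans (ler_avg N (fun s _ => cvx (u s) (v s))) _.
rewrite avgD !avgZ A2 B2.
have sqa : A ^+ 2 <= a ^+ 2 by rewrite ler_sqr ?nnegrE ?(ltW a0)// /a; lra.
have sqb : B ^+ 2 <= b ^+ 2 by rewrite ler_sqr ?nnegrE ?(ltW b0)// /b; lra.
have -> : (a + b) ^+ 2 = (a + b) / a * a ^+ 2 + (a + b) / b * b ^+ 2.
  by field; rewrite !gt_eqF.
by rewrite lerD// ler_wpM2l// divr_ge0// ltW.
Qed.

(** * Rademacher functions on dyadic intervals *)

(** The offset [n] is the generation of the dyadic interval at hand: the functions up to [r_n] are
    already constant there. *)
Fixpoint rads (R : realType) (N n : nat) (t : R) : seq R :=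
  if N is N'.+1 then rademacher n.+1 t :: rads N' n.+1 t else [::].

Lemma nth_rads (R : realType) N n (t : R) k :
  (k < N)%N -> (rads N n t)`_k = rademacher (n + k).+1 t.
Proof.
elim: N n k => // N IH n [|k] kN /=; first by rewrite addn0.
by rewrite IH // addSnnS.
Qed.

(** With [k = 2q + e], the point [2^(n+1) * pi * t] lies strictly between [k * pi] and
    [(k + 1) * pi], where the sine has sign [(-1)^k = (-1)^e]. *)
Lemma rademacher_dyadic (R : realType) n (q : nat) (e : bool) (t : R) :
  ((q.*2 + e)%:R / 2 ^+ n.+1 < t < (q.*2 + e).+1%:R / 2 ^+ n.+1) ->
  rademacher n.+1 t = (-1) ^+ e.
Proof.
rewrite ltr_pdivrMr ?exprn_gt0// ltr_pdivlMr ?exprn_gt0// => /andP[t1 t2].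
pose x := (2 ^+ n.+1 * t - (q.*2 + e)%:R) * pi.
have sx : 0 < sin x.
  apply: sin_gt0_pi; rewrite /x; apply/andP; split.
    by rewrite mulr_gt0 ?pi_gt0// subr_gt0 mulrC.
  rewrite -[X in _ < X]mul1r ltr_pM2r ?pi_gt0// ltrBlDr mulrC.
  by rewrite (lt_le_trans t2)// -natr1 addrC.
have -> : rademacher n.+1 t = Num.sg (sin (x + pi *+ (q.*2 + e))).
  by rewrite /rademacher /x; congr (Num.sg (sin _)); rewrite -mulr_natr; ring.
rewrite (alternatingn (@sinDpi R)) exprD -mul2n exprM sqrrN expr1n expr1n mul1r.
by rewrite sgrM (gtr0_sg sx) mulr1; case: e {t1 t2 x sx}; rewrite ?sgrN sgr1.
Qed.

(** The midpoint is a null set. Open intervals are used because [sin], and so the Rademacher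
    function, vanishes at dyadic endpoints. Measurability is carried along to justify the
    splitting. *)
Lemma integral_itv_split (R : realType) (a b c : R) (f : R -> R) :
  a < b -> b < c ->
  measurable_fun `]a, b[ f -> measurable_fun `]b, c[ f ->
  measurable_fun `]a, c[ f /\
  (\int[lebesgue_measure]_(t in `]a, c[) (f t)%:E =
   \int[lebesgue_measure]_(t in `]a, b[) (f t)%:E +
   \int[lebesgue_measure]_(t in `]b, c[) (f t)%:E)%E.
Proof.
move=> ab bc mab mbc.
have mab' : measurable_fun `]a, b] f by exact/measurable_fun_itv_bndo_bndcP.
have E : `]a, c[%classic = `]a, b] `|` `]b, c[ :> set R.
  by apply: itv_bndbnd_setU; rewrite bnd_simp ?ltW.
have mac : measurable_fun `]a, c[ f by rewrite E; apply/measurable_funU.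
split=> //; rewrite [in LHS]E integral_setU//.
- by congr (_ + _)%E; apply: integral_itv_bndoo; exact/measurable_EFinP.
- by rewrite -E; exact/measurable_EFinP.
- apply/disj_setPS => t [] /=; rewrite !in_itv/= => /andP[_ tb] /andP[bt _].
  by have := lt_le_trans bt tb; rewrite ltxx.
Qed.

(** Induction on [N]: [r_(n+1)] is 1 on the left half of [I] and -1 on the right half, and these
    halves are the intervals number [2q] and [2q + 1] of generation [n + 1]. *)
Lemma integral_dyadic (R : realType) N n (q : nat) (g : seq R -> R) :
  let I : set R := `]q%:R / 2 ^+ n, q.+1%:R / 2 ^+ n[%classic in
  measurable_fun I (fun t => g (rads N n t)) /\
  (\int[lebesgue_measure]_(t in I) (g (rads N n t))%:E =
   (avg N g / 2 ^+ n)%:E)%E.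
Proof.
elim: N n q g => [|N IH] n q g I.
  split=> /=; first exact: measurable_cst.
  have muI : lebesgue_measure I = (2 ^+ n)^-1%:E.
    rewrite /I lebesgue_measure_itv/= lte_fin.
    rewrite ltr_pM2r ?invr_gt0 ?exprn_gt0// ltr_nat ltnSn.
    by rewrite -EFinD -mulrBl -natrB// subSnn mul1r.
  transitivity ((g [::])%:E * lebesgue_measure I)%E; last by rewrite muI EFinM.
  apply: (integral_cst (lebesgue_measure : {measure set _ -> \bar R})).
  exact: measurable_itv.
pose h (e : bool) := fun s => g ((-1) ^+ e :: s).
have half (e : bool) : let J : set R :=
    `](q.*2 + e)%:R / 2 ^+ n.+1, (q.*2 + e).+1%:R / 2 ^+ n.+1[%classic in
    measurable_fun J (fun t => g (rads N.+1 n t)) /\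
    (\int[lebesgue_measure]_(t in J) (g (rads N.+1 n t))%:E =
     (avg N (h e) / 2 ^+ n.+1)%:E)%E.
  move=> J; have [mJ iJ] := IH n.+1 (q.*2 + e)%N (h e).
  have gh : {in J, (fun t => h e (rads N n.+1 t)) =1
                   (fun t => g (rads N.+1 n t))}.
    move=> t; rewrite inE /J /= in_itv/= => tJ.
    by rewrite /h (rademacher_dyadic tJ).
  split; first exact: eq_measurable_fun mJ.
  by rewrite -iJ; apply: eq_integral => t tJ; rewrite -gh.
have [m0 i0] := half false; have [m1 i1] := half true.
move: m0 i0 m1 i1; rewrite addn0 addn1.
have -> : q.*2.+2 = q.+1.*2 by [].
have dbl m : m.*2%:R / 2 ^+ n.+1 = m%:R / 2 ^+ n :> R.
  by rewrite -muln2 natrM exprS invfM; field; rewrite expf_neq0.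
rewrite !dbl => m0 i0 m1 i1.
have lt0 : q%:R / 2 ^+ n < q.*2.+1%:R / 2 ^+ n.+1 :> R.
  by rewrite -dbl ltr_pM2r ?invr_gt0 ?exprn_gt0// ltr_nat.
have lt1 : q.*2.+1%:R / 2 ^+ n.+1 < q.+1%:R / 2 ^+ n :> R.
  by rewrite -dbl ltr_pM2r ?invr_gt0 ?exprn_gt0// ltr_nat.
have [m i] := integral_itv_split lt0 lt1 m0 m1.
split=> //; rewrite i i0 i1 -EFinD; congr (_%:E) => /=.
by rewrite /h expr0 expr1 exprS; field; rewrite expf_neq0.
Qed.

(** This is the interval of generation 0, up to its endpoints. *)
Lemma integral_rads (R : realType) N (g : seq R -> R) :
  (\int[lebesgue_measure]_(t in `[0%R, 1%R]) (g (rads N 0 t))%:E =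
   (avg N g)%:E)%E.
Proof.
have [] := integral_dyadic N 0 0 g.
rewrite expr0 !divr1 => m <-.
by apply: integral_itv_bndoo; exact/measurable_EFinP.
Qed.

(** * Scalar fields and real-valued norms *)

(** These laws let the real and complex cases be treated at once. The parallelogram law serves only
    to compute [phi] on scalars. *)
Record scalar_laws (R : realType) (K : scalar_field R) : Prop := {
  of_real1 : of_real K 1 = 1;
  of_realD : forall x y, of_real K (x + y) = of_real K x + of_real K y;
  of_realM : forall x y, of_real K (x * y) = of_real K x * of_real K y;
  of_realK : cancel (of_real K) (@real_part R K);
  real_partK : forall z : K, 0 <= z -> of_real K (real_part z) = z;
  ler_of_real : forall x y, (of_real K x <= of_real K y) = (x <= y);
  parallelogram : forall u v : K,
    real_part `|u + v| ^+ 2 + real_part `|u - v| ^+ 2 =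
    2 * (real_part `|u| ^+ 2 + real_part `|v| ^+ 2) }.

Lemma real_scalar_laws (R : realType) : scalar_laws (real_scalars R).
Proof.
split=> //= u v.
by rewrite !real_normK ?num_real//; ring.
Qed.

Lemma complex_scalar_laws (R : realType) : scalar_laws (complex_scalars R).
Proof.
have nrm2 (z : R[i]) :
    complex.Re `|z| ^+ 2 = complex.Re z ^+ 2 + complex.Im z ^+ 2.
  by case: z => a b; rewrite normc_def /= sqr_sqrtr// addr_ge0// sqr_ge0.
split.
- by [].
- by move=> x y; apply/eqP; rewrite eq_complex /= addr0 !eqxx.
- move=> x y; apply/eqP; rewrite eq_complex /=.
  by rewrite !(mul0r, mulr0, subr0, addr0) !eqxx.
- by [].
- by move=> [a b]; rewrite lecE /= => /andP[/eqP <-].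
- by move=> x y; rewrite /= lecR.
(* Both transitivities hold by conversion; they display the norms over [R[i]] so that [nrm2]
   applies. *)
- move=> u v; transitivity (complex.Re (`|u + v : R[i]|) ^+ 2 +
    complex.Re (`|u - v : R[i]|) ^+ 2) => //.
  transitivity (2 * (complex.Re (`|u : R[i]|) ^+ 2 +
    complex.Re (`|v : R[i]|) ^+ 2)) => //.
  by rewrite !nrm2; case: u v => [a b] [c d] /=; ring.
Qed.

Section Norms.
Context {R : realType} {K : scalar_field R} (lawK : scalar_laws K).
Implicit Types V : normedModType K.

Lemma of_real0 : of_real K 0 = 0.
Proof. by apply: (addrI (of_real K 0)); rewrite -of_realD// !addr0. Qed.

Lemma of_realN x : of_real K (- x) = - of_real K x.
Proof.
by apply/eqP; rewrite -addr_eq0 -of_realD// addNr of_real0.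
Qed.

Lemma normr_of_real x : `|of_real K x| = of_real K `|x|.
Proof.
have [x0|x0] := leP 0 x; first by rewrite !ger0_norm// -of_real0 ler_of_real.
by rewrite !ler0_norm ?of_realN// ?(ltW x0)// -of_real0 ler_of_real// ltW.
Qed.

Lemma nrmE V (v : V) : `|v| = of_real K (nrm v).
Proof. by rewrite real_partK. Qed.

Lemma nrm_ge0 V (v : V) : 0 <= nrm v.
Proof. by rewrite -(ler_of_real lawK) of_real0 -nrmE. Qed.

Lemma nrm0 V : nrm (0 : V) = 0.
Proof. by rewrite /nrm normr0 -of_real0 of_realK. Qed.

Lemma nrm_eq0 V (v : V) : (nrm v == 0) = (v == 0).
Proof.
apply/eqP/eqP => [v0|->]; last exact: nrm0.
by apply: normr0_eq0; rewrite nrmE v0 of_real0.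
Qed.

Lemma nrm_gt0 V (v : V) : (0 < nrm v) = (v != 0).
Proof. by rewrite lt_neqAle nrm_ge0 andbT eq_sym nrm_eq0. Qed.

Lemma nrmN V (v : V) : nrm (- v) = nrm v.
Proof. by rewrite /nrm normrN. Qed.

Lemma ler_nrmD V (u v : V) : nrm (u + v) <= nrm u + nrm v.
Proof.
by rewrite -(ler_of_real lawK) of_realD// -!nrmE ler_normD.
Qed.

Lemma nrmZ V (a : K) (v : V) : nrm (a *: v) = real_part `|a| * nrm v.
Proof.
apply: (can_inj (of_realK lawK)).
by rewrite of_realM// -!nrmE normrZ.
Qed.

Lemma nrmZ_of_real V x (v : V) : nrm (of_real K x *: v) = `|x| * nrm v.
Proof. by rewrite nrmZ normr_of_real of_realK. Qed.

Lemma real_part_norm_ge0 (a : K) : 0 <= real_part `|a|.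
Proof. by rewrite -(ler_of_real lawK) of_real0 real_partK. Qed.

Lemma ler_nrm_sum V N (w : 'I_N -> V) :
  nrm (\sum_k w k) <= \sum_k nrm (w k).
Proof.
elim/big_ind2: _ => [|x a y b xa yb|//]; first by rewrite nrm0.
by rewrite (le_trans (ler_nrmD _ _))// lerD.
Qed.

End Norms.

(** * The Rademacher seminorm and the type inequality *)

(* [phi w] is the norm of [\sum_k r_k w_k] in L^2([0,1]; V), see [type_ineqE]. *)
Definition phi (R : realType) (K : scalar_field R) (V : normedModType K) N
    (w : 'I_N -> V) : R :=
  Num.sqrt (avg N (fun s => nrm (\sum_(k < N) of_real K s`_k *: w k) ^+ 2)).

Section Phi.
Context {R : realType} {K : scalar_field R} (lawK : scalar_laws K).
Implicit Types V W : normedModType K.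

Lemma phi_ge0 V N (w : 'I_N -> V) : 0 <= phi w.
Proof. exact: sqrtr_ge0. Qed.

Lemma sqr_phi V N (w : 'I_N -> V) :
  phi w ^+ 2 = avg N (fun s => nrm (\sum_(k < N) of_real K s`_k *: w k) ^+ 2).
Proof. by rewrite sqr_sqrtr// avg_ge0// => s; exact: sqr_ge0. Qed.

Lemma phiD V N (u v : 'I_N -> V) : phi (fun k => u k + v k) <= phi u + phi v.
Proof.
apply: le_trans (avg_minkowski _ _ _); apply: ler_wsqrtr; apply: ler_avg => s _.
rewrite ler_sqr ?nnegrE ?addr_ge0 ?nrm_ge0//.
under eq_bigr do rewrite scalerDr.
by rewrite big_split ler_nrmD.
Qed.

(** Each sign vector is one choice of [b]. The families may lie in different spaces: this covers
    both the image under an operator and scalar multiples of a fixed vector. *)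
Lemma phi_bound V W N (w : 'I_N -> V) (w' : 'I_N -> W) (c : R) : 0 <= c ->
  (forall b : 'I_N -> K,
    nrm (\sum_k b k *: w k) <= c * nrm (\sum_k b k *: w' k)) ->
  phi w <= c * phi w'.
Proof.
move=> c0 ww'; rewrite -[c * _]ger0_norm ?mulr_ge0 ?phi_ge0// -sqrtr_sqr.
apply: ler_wsqrtr; rewrite exprMn sqr_phi -avgZ; apply: ler_avg => s _.
by rewrite -exprMn ler_sqr ?nnegrE ?mulr_ge0 ?nrm_ge0.
Qed.

(** A crude bound, enough to make finitely many small terms negligible in limits. *)
Lemma phi_le_sum V N (w : 'I_N -> V) : phi w <= \sum_k nrm (w k).
Proof.
have S0 : 0 <= \sum_k nrm (w k) by apply: sumr_ge0 => k _; exact: nrm_ge0.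
rewrite -[leRHS]ger0_norm// -sqrtr_sqr; apply: ler_wsqrtr.
rewrite -[leRHS](avg_cst N); apply: ler_avg => s s1.
rewrite ler_sqr ?nnegrE ?nrm_ge0//; apply: le_trans (ler_nrm_sum lawK _) _.
by apply: ler_sum => k _; rewrite nrmZ_of_real// ler_piMl ?nrm_ge0.
Qed.

Lemma phi_ord1 V (v : V) : phi (fun _ : 'I_1 => v) = nrm v.
Proof.
rewrite /phi /= !big_ord1 /= !nrmZ_of_real// normrN normr1 mul1r.
rewrite [X in Num.sqrt X](_ : _ = nrm v ^+ 2); last by field.
by rewrite sqrtr_sqr ger0_norm ?nrm_ge0.
Qed.

(** Orthonormality of the Rademacher functions, obtained from the parallelogram law one sign at a
    time. *)
Lemma sqr_phi_scalars N (c : 'I_N -> K) :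
  phi (V := K) c ^+ 2 = \sum_k real_part `|c k| ^+ 2.
Proof.
pose q (z : K) := real_part `|z| ^+ 2.
(* The shift [z] absorbs the signs already fixed; averaging over the next sign replaces [q (z + c)]
   and [q (z - c)] by [q z + q c]. *)
have avgq z : avg N (fun s => q (z + \sum_(k < N) of_real K s`_k *: (c k : K))) =
    q z + \sum_k q (c k).
  elim: N c z => [|N IH] c z /=.
    by rewrite !big_ord0 !addr0.
  have step e : avg N (fun s => q (z + \sum_(k < N.+1)
      of_real K (e :: s)`_k *: (c k : K))) =
      q (z + of_real K e *: (c ord0 : K)) + \sum_(k < N) q (c (lift ord0 k)).
    by rewrite -IH; apply: eq_avg => s; rewrite big_ord_recl addrA.
  rewrite !step big_ord_recl of_realN// !of_real1// scaleN1r scale1r.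
  have := parallelogram lawK z (c ord0); rewrite -!/(q _) => pl.
  by lra.
have q0 : q 0 = 0 by rewrite /q normr0 -(of_real0 lawK) of_realK// expr0n.
rewrite sqr_phi; transitivity (q 0 + \sum_k q (c k)); last by rewrite q0 add0r.
by rewrite -avgq; apply: eq_avg => s; rewrite add0r.
Qed.

Definition lpnorm (p : R) V N (a : 'I_N -> R) (x y : 'I_N -> V) : R :=
  (\sum_(k < N) `|a k| `^ p * nrm (x k - y k) `^ p) `^ p^-1.

Definition diffs V W (f : V -> W) N (a : 'I_N -> R) (x y : 'I_N -> V) :
  'I_N -> W := fun k => of_real K (a k) *: (f (x k) - f (y k)).

(** The integrand depends on [t] only through [rads N 0 t], so [integral_rads] turns the integral
    into the average in [phi]. *)
Lemma type_ineqE (p : R) V W (f : V -> W) (C : R) :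
  type_ineq p f C <->
  forall N (a : 'I_N -> R) x y, phi (diffs f a x y) <= C * lpnorm p a x y.
Proof.
have intE N (a : 'I_N -> R) x y :
    ((\int[lebesgue_measure]_(t in `[0%R, 1%R])
        ((nrm (\sum_(k < N) of_real K (a k * rademacher k.+1 t) *:
                 (f (x k) - f (y k)))) ^+ 2)%:E) `^ 2^-1)%E =
    (phi (diffs f a x y))%:E.
  rewrite /phi -powR12_sqrt; last by apply: avg_ge0 => s; exact: sqr_ge0.
  rewrite -poweR_EFin -integral_rads; congr (_ `^ _)%E.
  apply: eq_integral => t _; congr ((nrm _ ^+ 2)%:E); apply: eq_bigr => k _.
  by rewrite nth_rads// add0n scalerA -of_realM// mulrC.
by split=> H N a x y; have := H N a x y; rewrite intE lee_fin.
Qed.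

End Phi.

(** * Estimates for the l_p norm *)

Section LpNorm.
Context {R : realType} {K : scalar_field R} (lawK : scalar_laws K).
Context (p : R) (hp : 1 < p <= 2).
Implicit Types V W : normedModType K.

Let p_gt0 : 0 < p. Proof. by case/andP: hp => p1 _; apply: lt_trans p1. Qed.
Let p_neq0 : p != 0. Proof. by rewrite gt_eqF. Qed.

Lemma lpnorm_ge0 V N (a : 'I_N -> R) (x y : 'I_N -> V) : 0 <= lpnorm p a x y.
Proof. exact: powR_ge0. Qed.

Lemma lpnorm_ord1 V (x y : V) :
  lpnorm p (fun _ : 'I_1 => 1) (fun=> x) (fun=> y) = nrm (x - y).
Proof.
by rewrite /lpnorm big_ord1 normr1 powR1 mul1r -powRrM mulfV// powRr1// nrm_ge0.
Qed.

Lemma lpnorm_lipschitz V W (h : V -> W) (L : R) N (a : 'I_N -> R) x y :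
  0 <= L -> (forall u v, nrm (h u - h v) <= L * nrm (u - v)) ->
  lpnorm p a (h \o x) (h \o y) <= L * lpnorm p a x y.
Proof.
move=> L0 hL; rewrite /lpnorm.
have -> : L = (L `^ p) `^ p^-1 by rewrite -powRrM mulfV// powRr1.
rewrite -powRM ?powR_ge0//; last first.
  by apply: sumr_ge0 => k _; rewrite mulr_ge0 ?powR_ge0.
have T0 (b : 'I_N -> R) : 0 <= \sum_k `|a k| `^ p * b k `^ p.
  by apply: sumr_ge0 => k _; rewrite mulr_ge0 ?powR_ge0.
apply: ge0_ler_powR; rewrite ?nnegrE ?invr_ge0 ?(ltW p_gt0)//.
  by rewrite mulr_ge0 ?powR_ge0.
rewrite mulr_sumr; apply: ler_sum => k _.
rewrite mulrCA -[L `^ p * _]powRM ?nrm_ge0// ler_wpM2l ?powR_ge0//.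
by apply: ge0_ler_powR; rewrite ?nnegrE ?mulr_ge0 ?nrm_ge0 ?(ltW p_gt0) ?hL.
Qed.

(** Each [b k] is at most the l_p norm [S], so [p <= 2] gives [b_k^2 = b_k^p * b_k^(2-p) <= b_k^p *
    S^(2-p)]; these bounds sum to [S^p * S^(2-p) = S^2]. *)
Lemma sqr_le_lpnorm V N (a : 'I_N -> R) (x y : 'I_N -> V) :
  \sum_k (`|a k| * nrm (x k - y k)) ^+ 2 <= lpnorm p a x y ^+ 2.
Proof.
pose b k := `|a k| * nrm (x k - y k).
have b0 k : 0 <= b k by rewrite mulr_ge0 ?nrm_ge0.
have -> : lpnorm p a x y = (\sum_k b k `^ p) `^ p^-1.
  by congr (_ `^ _); apply: eq_bigr => k _; rewrite powRM ?nrm_ge0.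
set T := \sum_k b k `^ p; set S := T `^ p^-1.
have T0 : 0 <= T by apply: sumr_ge0 => k _; exact: powR_ge0.
have S0 : 0 <= S by exact: powR_ge0.
have TS : T = S `^ p by rewrite -powRrM mulVf// powRr1.
have p2 : 0 <= 2 - p by case/andP: hp => _; rewrite subr_ge0.
have bS k : b k <= S.
  have -> : b k = (b k `^ p) `^ p^-1 by rewrite -powRrM mulfV// powRr1.
  apply: ge0_ler_powR; rewrite ?nnegrE ?invr_ge0 ?(ltW p_gt0) ?powR_ge0//.
  by rewrite /T (bigD1 k)//= lerDl sumr_ge0// => j _; exact: powR_ge0.
have sqE c : 0 <= c -> c ^+ 2 = c `^ p * c `^ (2 - p).
  have p22 : p + (2 - p) = 2 by ring.
  by move=> c0; rewrite -powRD p22 ?pnatr_eq0// powR_mulrn.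
rewrite [leRHS]sqE// -TS /T mulr_suml; apply: ler_sum => k _.
rewrite -/(b k) sqE// ler_wpM2l ?powR_ge0//.
by apply: ge0_ler_powR; rewrite ?nnegrE.
Qed.

End LpNorm.

(** * Lipschitz constants and operator norms *)

Section Lipschitz.
Context {R : realType} {K : scalar_field R} (lawK : scalar_laws K).
Implicit Types V W : normedModType K.

Lemma Lip0_bound V W (f : V -> W) (C : R) : f 0 = 0 ->
  (forall x y, nrm (f x - f y) <= C * nrm (x - y)) -> Lip0 f.
Proof.
move=> f0 fC; split=> //; exists (of_real K C) => -[x y] _ /=.
by rewrite !nrmE// -of_realM// ler_of_real.
Qed.

Lemma nrm_sub_le_Lip V W (f : V -> W) x y :
  Lip0 f -> nrm (f x - f y) <= Lip f * nrm (x - y).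
Proof.
move=> [_ [k fk]]; have [->|xy] := eqVneq x y.
  by rewrite !subrr !nrm0// mulr0.
have xy0 : 0 < nrm (x - y) by rewrite nrm_gt0// subr_eq0.
rewrite -ler_pdivrMr//; apply: sup_upper_bound; last by exists x, y.
split; first by exists (nrm (f x - f y) / nrm (x - y)), x, y.
exists (real_part k) => _ [u [v [uv ->]]].
have uv0 : 0 < nrm (u - v) by rewrite nrm_gt0// subr_eq0.
have := fk (u, v) (conj I I); rewrite /= !nrmE// => fuv.
have uvK : 0 < of_real K (nrm (u - v)).
  by rewrite -nrmE// normr_gt0 subr_eq0.
(* The constant [k] lies in [K]; two distinct points force it to be nonnegative, hence the image of
   a real number. *)
have k0 : 0 <= k.
  have : 0 <= k * of_real K (nrm (u - v)).
    by apply: le_trans fuv; rewrite -nrmE.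
  by rewrite pmulr_lge0.
move: fuv; rewrite -(real_partK lawK k0) -of_realM// ler_of_real//.
by rewrite ler_pdivrMr// of_realK.
Qed.

Lemma Lip_le V W (f : V -> W) (D : R) : 0 <= D ->
  (forall x y, nrm (f x - f y) <= D * nrm (x - y)) -> Lip f <= D.
Proof.
move=> D0 fD; rewrite /Lip; set A := (X in sup X).
(* On the zero space there are no quotients and the supremum is 0 by default; [0 <= D] covers this
   case. *)
have [->|A0] := eqVneq A set0; first by rewrite sup0.
apply: ge_sup; first exact/set0P.
move=> _ [x [y [xy ->]]].
by rewrite ler_pdivrMr// nrm_gt0// subr_eq0.
Qed.

Lemma Lip_ge0 V W (f : V -> W) : Lip0 f -> 0 <= Lip f.
Proof.
move=> lf; rewrite /Lip; set A := (X in sup X).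
have [->|/set0P[_ [x [y [xy _]]]]] := eqVneq A set0; first by rewrite sup0.
have xy0 : 0 < nrm (x - y) by rewrite nrm_gt0// subr_eq0.
rewrite -(pmulr_lge0 _ xy0).
by apply: le_trans (nrm_sub_le_Lip x y lf); exact: nrm_ge0.
Qed.

Lemma bounded_linear0 V W (T : V -> W) : bounded_linear T -> T 0 = 0.
Proof.
move=> [lT _]; have := lT (-1) 0 0.
by rewrite scaleN1r oppr0 addr0 scaleN1r addNr.
Qed.

Lemma bounded_linear_sum V W (T : V -> W) N (b : 'I_N -> K) (w : 'I_N -> V) :
  bounded_linear T -> T (\sum_k b k *: w k) = \sum_k b k *: T (w k).
Proof.
move=> bT; apply: (big_ind2 (fun u v => T u = v)) => [|x _ y _ <- <-|k _].
- exact: bounded_linear0.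
- by have := bT.1 1 x y; rewrite !scale1r.
- by have := bT.1 (b k) (w k) 0; rewrite (bounded_linear0 bT) !addr0.
Qed.

Lemma nrm_le_opnorm V W (T : V -> W) x :
  bounded_linear T -> nrm (T x) <= opnorm T * nrm x.
Proof.
move=> bT; have [T_lin [M TM]] := bT.
have [->|x0] := eqVneq x 0; first by rewrite (bounded_linear0 bT) !nrm0// mulr0.
have nx0 : 0 < nrm x by rewrite nrm_gt0.
have TZ c u : T (c *: u) = c *: T u.
  by have := T_lin c u 0; rewrite (bounded_linear0 bT) !addr0.
have ub : has_sup [set nrm (T x) | x in [set x : V | nrm x <= 1]].
  split; first by exists (nrm (T 0)), 0 => //=; rewrite nrm0.
  (* [M] has no prescribed sign, hence the absolute value. *)
  exists `|M| => _ [u /= u1 <-]; apply: le_trans (TM u) _.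
  apply: le_trans (ler_norm _) _; rewrite normrM (ger0_norm (nrm_ge0 _ _))//.
  by rewrite ler_piMr.
rewrite -ler_pdivrMr//; apply: sup_upper_bound => //.
exists (of_real K (nrm x)^-1 *: x) => /=.
  by rewrite nrmZ_of_real// ger0_norm ?invr_ge0 ?(ltW nx0)// mulVf ?gt_eqF.
by rewrite TZ nrmZ_of_real// ger0_norm ?invr_ge0 ?(ltW nx0)// mulrC.
Qed.

Lemma opnorm_ge0 V W (T : V -> W) : bounded_linear T -> 0 <= opnorm T.
Proof.
move=> bT; have [x0|x0] := pselect (exists x : V, x != 0).
  have [x xn0] := x0; have nx0 : 0 < nrm x by rewrite nrm_gt0.
  rewrite -(pmulr_lge0 _ nx0).
  by apply: le_trans (nrm_le_opnorm x bT); exact: nrm_ge0.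
rewrite /opnorm [X in sup X](_ : _ = [set 0]) ?sup1//.
have V0 (x : V) : x = 0.
  by apply/eqP; apply: contrapT => /negP xn0; apply: x0; exists x.
apply/seteqP; split=> [_ [x _ <-]|_ ->] /=.
  by rewrite (V0 x) (bounded_linear0 bT) nrm0.
by exists 0 => /=; rewrite ?(bounded_linear0 bT) ?nrm0.
Qed.

End Lipschitz.

(** * Stability of the type inequality *)

Section TypeIdeal.
Context {R : realType} {K : scalar_field R} (lawK : scalar_laws K).
Context (p : R) (hp : 1 < p <= 2).
Implicit Types V W : normedModType K.
Implicit Types X E : completeNormedModType K.

Lemma type_ineq_Lipschitz V W (f : V -> W) (C : R) x y :
  type_ineq p f C -> nrm (f x - f y) <= C * nrm (x - y).
Proof.
move=> /(type_ineqE lawK)/(_ 1 (fun=> 1) (fun=> x) (fun=> y)).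
rewrite lpnorm_ord1// => fC; apply: le_trans fC.
by rewrite -[leLHS](phi_ord1 lawK) /diffs of_real1// scale1r.
Qed.

Lemma type_ineq_le V W (f : V -> W) (C D : R) :
  C <= D -> type_ineq p f C -> type_ineq p f D.
Proof.
move=> CD /(type_ineqE lawK) fC; apply/(type_ineqE lawK) => N a x y.
by apply: le_trans (fC N a x y) _; rewrite ler_wpM2r ?lpnorm_ge0.
Qed.

(** For fixed data the inequality is closed in [C]. This will show that the infimum of the constants
    is itself a constant. *)
Lemma type_ineq_closed V W (f : V -> W) (C : R) :
  (forall e, 0 < e -> type_ineq p f (C + e)) -> type_ineq p f C.
Proof.
move=> fC; apply/(type_ineqE lawK) => N a x y; apply/ler_addgt0Pr => e e0.
have l0 : 0 <= lpnorm p a x y by exact: lpnorm_ge0.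
set l := lpnorm p a x y in l0 *.
(* [l] may be 0, so [e] is divided by [l + 1]. *)
have l1 : 0 < l + 1 by rewrite ltr_wpDl.
have /(type_ineqE lawK)/(_ N a x y) := fC (e / (l + 1)) (divr_gt0 e0 l1).
rewrite -/l mulrDl => /le_trans; apply; rewrite lerD2l mulrAC ler_pdivrMr//.
by rewrite ler_pM2l// lerDl.
Qed.

Lemma type_ineq0 V W : type_ineq p (fun _ : V => 0 : W) 0.
Proof.
apply/(type_ineqE lawK) => N a x y; rewrite mul0r.
apply: le_trans (phi_le_sum lawK _) _; rewrite big1// => k _.
by rewrite /diffs subrr scaler0 nrm0.
Qed.

Lemma type_ineqD V W (f g : V -> W) (C D : R) :
  type_ineq p f C -> type_ineq p g D -> type_ineq p (f \+ g) (C + D).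
Proof.
move=> /(type_ineqE lawK) fC /(type_ineqE lawK) gD.
apply/(type_ineqE lawK) => N a x y; rewrite mulrDl.
have -> : diffs (f \+ g) a x y = fun k => diffs f a x y k + diffs g a x y k.
  by apply/funext => k; rewrite /diffs -scalerDr opprD addrACA.
by apply: le_trans (phiD lawK _ _) _; exact: lerD.
Qed.

(** The inequality for [f] is used at the points [h (x k)] and [h (y k)]; [h] costs a factor [L] in
    the l_p norm and [T] a factor [M] in [phi]. *)
Lemma type_ineq_comp V0 V W W0 (T : W -> W0) (f : V -> W) (h : V0 -> V)
    (M C L : R) :
  bounded_linear T -> 0 <= M -> (forall w, nrm (T w) <= M * nrm w) ->
  0 <= L -> (forall u v, nrm (h u - h v) <= L * nrm (u - v)) ->
  0 <= C -> type_ineq p f C -> type_ineq p (T \o f \o h) (M * C * L).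
Proof.
move=> bT M0 TM L0 hL C0 /(type_ineqE lawK) fC.
apply/(type_ineqE lawK) => N a x y.
apply: (@le_trans _ _ (M * phi (diffs f a (h \o x) (h \o y)))).
  apply: phi_bound => // b; rewrite (_ : \sum_k _ =
    T (\sum_k b k *: diffs f a (h \o x) (h \o y) k)) ?TM//.
  rewrite (bounded_linear_sum _ _ bT); apply: eq_bigr => k _; congr (_ *: _).
  have TZ c u : T (c *: u) = c *: T u.
    by have := bT.1 c u 0; rewrite (bounded_linear0 bT) !addr0.
  have := bT.1 (-1) (f (h (y k))) (f (h (x k))).
  by rewrite /diffs TZ /= !scaleN1r addrC => <-; rewrite addrC.
rewrite -!mulrA ler_wpM2l//; apply: le_trans (fC _ _ _ _) _.
by rewrite ler_wpM2l// lpnorm_lipschitz.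
Qed.

Lemma type_ineq_rank1 V W (h : V -> K) (w : W) :
  Lip0 h -> type_ineq p (fun x => h x *: w) (Lip h * nrm w).
Proof.
move=> lh; apply/(type_ineqE lawK) => N a x y.
have Lh0 := Lip_ge0 lawK lh.
(* The fixed vector [w] factors out, which leaves the scalar map [h]. *)
apply: (@le_trans _ _ (nrm w * phi (V := K) (diffs h a x y))).
  apply: phi_bound => [//||b]; first exact: nrm_ge0.
  rewrite (_ : \sum_k _ = (\sum_k b k *: diffs h a x y k) *: w).
    by rewrite nrmZ// mulrC.
  rewrite scaler_suml; apply: eq_bigr => k _.
  by rewrite /diffs -scalerBl !scalerA.
rewrite -[Lip h * _]mulrC -mulrA ler_wpM2l ?nrm_ge0//.
rewrite -ler_sqr ?nnegrE ?phi_ge0 ?mulr_ge0 ?lpnorm_ge0// sqr_phi_scalars//.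
(* For scalars [phi] is an l_2 norm, bounded by the l_p norm of the same increments of [h]. *)
apply: (@le_trans _ _ (lpnorm p a (h \o x) (h \o y) ^+ 2)).
  apply: le_trans (sqr_le_lpnorm lawK hp _ _ _).
  apply: ler_sum => k _; rewrite le_eqVlt; apply/orP; left; apply/eqP.
  congr (_ ^+ 2).
  exact: (nrmZ_of_real lawK (a k) ((h (x k) - h (y k)) : K)).
rewrite ler_sqr ?nnegrE ?mulr_ge0 ?lpnorm_ge0//.
by apply: lpnorm_lipschitz => // u v; exact: nrm_sub_le_Lip.
Qed.

(** * The type norm *)

Lemma lip_type_of X E (f : X -> E) (C : R) :
  f 0 = 0 -> 0 <= C -> type_ineq p f C -> lip_type p f.
Proof.
move=> f0 C0 fC; split.
  by apply: (Lip0_bound lawK (C := C)) => // x y; exact: type_ineq_Lipschitz.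
(* [C] may be 0, while [lip_type] asks for a positive constant. *)
exists (C + 1); first by rewrite ltr_wpDl.
by apply: type_ineq_le fC; rewrite lerDl.
Qed.

Lemma lip_type_norm_ge0 X E (f : X -> E) : lip_type p f ->
  0 <= lip_type_norm p f.
Proof.
move=> [_ [C C0 fC]]; apply: lb_le_inf; first by exists C.
by move=> D [/ltW].
Qed.

Lemma lip_type_norm_le X E (f : X -> E) (C : R) :
  0 <= C -> type_ineq p f C -> lip_type_norm p f <= C.
Proof.
move=> C0 fC; apply/ler_addgt0Pr => e e0.
apply: ge_inf; first by exists 0 => D [/ltW].
split; first by rewrite ltr_wpDl.
by apply: type_ineq_le fC; rewrite lerDl ltW.
Qed.

(** Constants arbitrarily close to the infimum are admissible, and [type_ineq_closed] passes to the
    limit. *)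
Lemma lip_type_normP X E (f : X -> E) : lip_type p f ->
  type_ineq p f (lip_type_norm p f).
Proof.
move=> [_ [C C0 fC]]; apply: type_ineq_closed => e e0.
have ne : [set C : R | 0 < C /\ type_ineq p f C] !=set0 by exists C.
have /(inf_lt ne)[D [_ fD] /ltW De] :
    lip_type_norm p f < lip_type_norm p f + e by rewrite ltrDl.
exact: type_ineq_le fD.
Qed.

Lemma lip_type0 X E (f : X -> E) : lip_type p f -> f 0 = 0.
Proof. by case=> -[]. Qed.

Lemma nrm_le_lip_type_norm X E (f : X -> E) x : lip_type p f ->
  nrm (f x) <= lip_type_norm p f * nrm x.
Proof.
move=> tf; have := type_ineq_Lipschitz x 0 (lip_type_normP tf).
by rewrite (lip_type0 tf) !subr0.
Qed.

Lemma lip_typeD X E (f g : X -> E) :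
  lip_type p f -> lip_type p g -> lip_type p (f + g).
Proof.
move=> tf tg; have := type_ineqD (lip_type_normP tf) (lip_type_normP tg).
apply: lip_type_of; last by rewrite addr_ge0// lip_type_norm_ge0.
by rewrite /= -[LHS]/(f 0 + g 0) (lip_type0 tf) (lip_type0 tg) addr0.
Qed.

Lemma type_ineqZ V W (c : K) (f : V -> W) (C : R) :
  0 <= C -> type_ineq p f C -> type_ineq p (c *: f) (real_part `|c| * C).
Proof.
move=> C0 fC; rewrite -[_ * C]mulr1.
apply: (@type_ineq_comp V V W W (fun w => c *: w) f id) => //.
- split; first by move=> a u v; rewrite scalerDr !scalerA mulrC.
  by exists (real_part `|c|) => w; rewrite nrmZ.
- exact: real_part_norm_ge0.
- by move=> w; rewrite nrmZ.
- by move=> u v; rewrite mul1r.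
Qed.

Lemma lip_typeZ X E (c : K) (f : X -> E) : lip_type p f -> lip_type p (c *: f).
Proof.
move=> tf; have N0 := lip_type_norm_ge0 tf.
apply: lip_type_of (type_ineqZ c N0 (lip_type_normP tf)).
- by rewrite -[LHS]/(c *: f 0) (lip_type0 tf) scaler0.
- by rewrite mulr_ge0// real_part_norm_ge0.
Qed.

Lemma lip_typeB X E (f g : X -> E) :
  lip_type p f -> lip_type p g -> lip_type p (f - g).
Proof.
by move=> tf tg; apply: lip_typeD => //; rewrite -scaleN1r; exact: lip_typeZ.
Qed.

Lemma lip_type_norm_leZ X E (c : K) (f : X -> E) : lip_type p f ->
  lip_type_norm p (c *: f) <= real_part `|c| * lip_type_norm p f.
Proof.
move=> tf; have N0 := lip_type_norm_ge0 tf.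
apply: lip_type_norm_le; first by rewrite mulr_ge0// real_part_norm_ge0.
by apply: type_ineqZ => //; exact: lip_type_normP.
Qed.

(** For nonzero [c] the reverse inequality is [lip_type_norm_leZ] for [c^-1], applied to
    [c *: f]. *)
Lemma lip_type_normZ X E (c : K) (f : X -> E) : lip_type p f ->
  lip_type_norm p (c *: f) = real_part `|c| * lip_type_norm p f.
Proof.
move=> tf; apply/eqP; rewrite eq_le lip_type_norm_leZ//=.
have [->|c0] := eqVneq c 0.
  rewrite normr0 -(of_real0 lawK) of_realK// mul0r.
  by rewrite of_real0// lip_type_norm_ge0//; exact: lip_typeZ.
have cV0 : 0 < real_part `|c| :> R.
  by rewrite lt_neqAle real_part_norm_ge0// andbT eq_sym (nrm_eq0 lawK (c : K)).
have := lip_type_norm_leZ c^-1 (lip_typeZ c tf).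
rewrite scalerA mulVf// scale1r.
have -> : real_part `|c^-1| = (real_part `|c|)^-1.
  apply: (mulfI (lt0r_neq0 cV0)); rewrite mulfV ?gt_eqF//.
  rewrite -[RHS](of_realK lawK) of_real1// -(normr1 K) -(mulfV c0).
  exact/esym/(nrmZ lawK c (c^-1 : K)).
by rewrite mulrC ler_pdivlMr// mulrC.
Qed.

(** * Completeness *)

Lemma ltr_of_real (x y : R) : (of_real K x < of_real K y) = (x < y).
Proof.
by rewrite !lt_neqAle ler_of_real// (inj_eq (can_inj (of_realK lawK))).
Qed.

(** The completeness of [E] speaks of balls with radius in [K]; [real_part] and [of_real] translate
    positive radii. *)
Lemma nrm_complete E (w : nat -> E) :
  (forall e : R, 0 < e -> exists n0, forall m n,
     (n0 <= m)%N -> (n0 <= n)%N -> nrm (w m - w n) < e) ->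
  exists v, forall e : R, 0 < e -> exists n0, forall n,
     (n0 <= n)%N -> nrm (w n - v) < e.
Proof.
move=> cw; have pos (e : K) : 0 < e -> 0 < real_part e.
  by move=> e0; rewrite -ltr_of_real of_real0// real_partK// ltW.
have : cvg (w @ \oo).
  apply: cauchy_cvg; apply: cauchy_exP => e e0.
  have [n0 cn0] := cw _ (pos _ e0); exists (w n0).
  exists n0 => // n /= n0n; rewrite -ball_normE /ball_ /=.
  by rewrite nrmE// -(real_partK lawK (ltW e0)) ltr_of_real; exact: cn0.
move=> /cvg_ex[v wv]; exists v => e e0.
have eK : 0 < of_real K e by rewrite -(of_real0 lawK) ltr_of_real.
have [n0 _ n0P] := (cvgrPdist_lt w v).1 wv _ eK.
exists n0 => n /n0P /=.
by rewrite distrC nrmE// ltr_of_real.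
Qed.

Lemma lip_type_complete X E (u : nat -> X -> E) :
  (forall n, lip_type p (u n)) ->
  (forall e : R, 0 < e -> exists n0, forall m n,
     (n0 <= m)%N -> (n0 <= n)%N -> lip_type_norm p (u m - u n) < e) ->
  exists2 v, lip_type p v & forall e : R, 0 < e -> exists n0, forall n,
     (n0 <= n)%N -> lip_type_norm p (u n - v) < e.
Proof.
move=> tu cu.
(* The type norm controls values at each [x] up to the factor [nrm x], so pointwise limits exist. *)
have /choice[v uv] : forall x, exists v, forall e : R, 0 < e ->
    exists n0, forall n, (n0 <= n)%N -> nrm (u n x - v) < e.
  move=> x; apply: nrm_complete => e e0.
  have d0 : 0 < nrm x + 1 by rewrite ltr_wpDl// nrm_ge0.
  have [n0 n0P] := cu _ (divr_gt0 e0 d0); exists n0 => m n n0m n0n.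
  have /le_lt_trans := nrm_le_lip_type_norm x (lip_typeB (tu m) (tu n)); apply.
  have := n0P m n n0m n0n; rewrite ltr_pdivlMr//; apply: le_lt_trans.
  by rewrite ler_wpM2l ?lip_type_norm_ge0 ?lerDl//; exact: lip_typeB.
(* An instance of the type inequality involves finitely many points, so convergence is uniform on
   them. *)
have approx N (z : 'I_N -> X) (e : R) : 0 < e -> exists n0, forall n k,
    (n0 <= n)%N -> nrm (u n (z k) - v (z k)) < e.
  move=> e0; have /choice[g gP] k := uv (z k) e e0.
  exists (\max_k g k) => n k /(leq_trans _) gn; apply: gP; apply: gn.
  exact: leq_bigmax.
have v0 : v 0 = 0.
  apply/eqP; rewrite -(nrm_eq0 lawK) eq_le nrm_ge0// andbT.
  apply/ler_addgt0Pr => e e0; rewrite add0r.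
  have [n0 n0P] := uv 0 e e0; have := n0P n0 (leqnn _).
  by rewrite lip_type0// sub0r nrmN => /ltW.
(* the tail [u n - v] inherits the bound of [u n - u m], letting m grow *)
have tail (e : R) : 0 < e -> exists n0, forall n, (n0 <= n)%N ->
    type_ineq p (u n - v) e.
  move=> e0; have [n0 n0P] := cu e e0; exists n0 => n n0n.
  apply/(type_ineqE lawK) => N a x y; apply/ler_addgt0Pr => d d0.
  pose A := \sum_k `|a k|; have A0 : 0 <= A by exact: sumr_ge0.
  (* Errors [d / (2A + 1)] at all points [x k] and [y k] add up to at most
     [2A * d / (2A + 1) <= d]. *)
  have A1 : 0 < 2 * A + 1 by rewrite ltr_wpDl// mulr_ge0.
  have [n1 n1P] := approx N x _ (divr_gt0 d0 A1).
  have [n2 n2P] := approx N y _ (divr_gt0 d0 A1).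
  (* [m] depends on the data, but the bound [e] on the norm of [u n - u m] does not. *)
  pose m := maxn n0 (maxn n1 n2).
  have tnm : lip_type p (u n - u m) by exact: lip_typeB.
  have -> : diffs (u n - v) a x y =
      fun k => diffs (u n - u m) a x y k + diffs (u m - v) a x y k.
    apply/funext => k; rewrite /diffs -scalerDr; congr (_ *: _).
    rewrite addrACA -opprD; congr (_ - _).
      exact/esym/(subrKA (u m (x k)) (u n (x k)) (- v (x k))).
    exact/esym/(subrKA (u m (y k)) (u n (y k)) (- v (y k))).
  apply: le_trans (phiD lawK _ _) _; apply: lerD.
    have /(type_ineqE lawK)/(_ N a x y) := lip_type_normP tnm.
    move=> /le_trans; apply; rewrite ler_wpM2r ?lpnorm_ge0//.
    by rewrite ltW// n0P// leq_maxl.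
  apply: le_trans (phi_le_sum lawK _) _.
  apply: (@le_trans _ _ (\sum_k `|a k| * (2 * (d / (2 * A + 1))))).
    apply: ler_sum => k _; rewrite nrmZ_of_real// ler_wpM2l//.
    apply: le_trans (ler_nrmD lawK _ _) _; rewrite nrmN mulr_natl mulr2n.
    by apply: lerD; apply: ltW; [apply: n1P|apply: n2P];
      rewrite /m !leq_max leqnn !orbT.
  rewrite -mulr_suml -/A !mulrA ler_pdivrMr//; lra.
(* [v] is the difference of [u n0] and [u n0 - v], both of type [p]. *)
have tv : lip_type p v.
  have [n0 n0P] := tail 1 ltr01.
  have tun : lip_type p (u n0 - v).
    apply: lip_type_of (n0P n0 (leqnn _)) => //.
    by rewrite !fctE /= v0 lip_type0// subrr.
  by rewrite -(subKr (u n0) v); exact: lip_typeB.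
(* [tail] yields only a weak inequality, hence [e / 2]. *)
exists v => // e e0; have [n0 n0P] := tail _ (divr_gt0 e0 (ltr0n R 2)).
exists n0 => n /n0P/lip_type_norm_le h.
by apply: le_lt_trans (h _) _; lra.
Qed.

(** * The ideal properties *)

Theorem lip_type_ideal :
  banach_lipschitz_ideal (@lip_type R K p) (@lip_type_norm R K p).
Proof.
split=> [X E f [] //|X E f|X E|X E f tf|X E h y lh|X0 X E E0 T f h bT tf lh].
- exact: lip_type_norm_ge0.
- split.
  + split=> [|f g|c f]; [|exact: lip_typeD|exact: lip_typeZ].
    exact: (@lip_type_of X E (fun=> 0) 0 erefl (lexx 0) (@type_ineq0 X E)).
  + split=> [f|f tf f0|f g tf tg|c f].
    * exact: lip_type_norm_ge0.
    * apply/funext => x; apply/eqP; rewrite -(nrm_eq0 lawK) eq_le nrm_ge0// andbT.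
      by have := nrm_le_lip_type_norm x tf; rewrite f0 mul0r.
    * apply: lip_type_norm_le; first by rewrite addr_ge0// lip_type_norm_ge0.
      by apply: type_ineqD; exact: lip_type_normP.
    * exact: lip_type_normZ.
  + exact: lip_type_complete.
- apply: (Lip_le lawK); first exact: lip_type_norm_ge0.
  by move=> x y; apply: type_ineq_Lipschitz; exact: lip_type_normP.
- have tr := type_ineq_rank1 y lh.
  have L0 := Lip_ge0 lawK lh; have y0 := nrm_ge0 lawK y.
  have th : lip_type p (fun x => h x *: y).
    apply: lip_type_of tr; first by rewrite lh.1 scale0r.
    exact: mulr_ge0.
  split=> //; apply/eqP; rewrite eq_le lip_type_norm_le ?mulr_ge0//=.
  (* For the lower bound, the Lipschitz estimate for [h x *: y] is divided by [nrm y]; it bounds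
     every quotient of [h]. *)
  have [y_eq0|yn0] := eqVneq y 0.
    by rewrite (_ : nrm y = 0) ?mulr0 ?lip_type_norm_ge0// y_eq0 nrm0.
  have ny0 : 0 < nrm y by rewrite nrm_gt0.
  rewrite -ler_pdivlMr//; apply: (Lip_le lawK).
    by rewrite divr_ge0// lip_type_norm_ge0.
  move=> u v; rewrite mulrAC ler_pdivlMr//.
  have := type_ineq_Lipschitz u v (lip_type_normP th).
  by rewrite -scalerBl nrmZ.
- have fN := lip_type_normP tf; have N0 := lip_type_norm_ge0 tf.
  have T0 := opnorm_ge0 lawK bT; have L0 := Lip_ge0 lawK lh.
  have tTfh : type_ineq p (T \o f \o h) (opnorm T * lip_type_norm p f * Lip h).
    apply: type_ineq_comp => //; first by move=> w; exact: nrm_le_opnorm.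
    by move=> u v; exact: nrm_sub_le_Lip.
  split; last by apply: lip_type_norm_le => //; rewrite !mulr_ge0.
  apply: lip_type_of tTfh; last by rewrite !mulr_ge0.
  by rewrite /= lh.1 (lip_type0 tf) (bounded_linear0 bT).
Qed.

End TypeIdeal.

Theorem theorem3p7 (R : realType) (p : R) (hp : 1 < p <= 2) :
  banach_lipschitz_ideal (@lip_type R (real_scalars R) p)
    (@lip_type_norm R (real_scalars R) p) /\
  banach_lipschitz_ideal (@lip_type R (complex_scalars R) p)
    (@lip_type_norm R (complex_scalars R) p).
Proof.
by split; apply: lip_type_ideal => //;
  [exact: real_scalar_laws|exact: complex_scalar_laws].
Qed.
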